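(* Let $X$ be a bipartite distance-regular graph of diameter $d\geq 4$ on $n$ vertices. If a halved graph of $X$ is primitive, then $\mathrm{motion}(X)\geq (2d)^{-2d-5}\,n$.
   Context: A distance-regular graph of diameter $d$ is a connected graph such that for vertices $v,w$ at distance $i$ the numbers of neighbours of $w$ at distance $i-1,i,i+1$ from $v$ are constants $c_i,a_i,b_i$. It is primitive if for every $1\le i\le d$ the distance-$i$ graph (same vertices, $u\sim v$ iff $\mathrm{dist}(u,v)=i$) is connected. For bipartite $X$, the halved graphs are the two connected components of the distance-2 graph of $X$ (one on each colour class); they are distance-regular. The motion of a graph is the minimum, over non-identity automorphisms, of the number of vertices not fixed. *)

(* Defs.v *)
From HB Require Import structures.
From mathcomp Require Import all_boot all_order all_algebra all_fingroup.
Set Implicit Arguments. Unset Strict Implicit. Unset Printing Implicit Defensive.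

(* A simple graph on a finite vertex type T is a symmetric irreflexive e : rel T. *)

Section Graph.
Variables (T : finType) (e : rel T).

Fixpoint walk (k : nat) (x y : T) : bool :=
  if k is k'.+1 then [exists z, e x z && walk k' z y] else x == y.

(* graph distance: least k with a walk of length k (shortest paths have
   length < #|T|); equals #|T| when y is unreachable from x *)
Definition dist (x y : T) : nat := find (fun k => walk k x y) (iota 0 #|T|).

Definition connected : Prop := forall x y : T, connect e x y.

Definition diam : nat := \max_(x : T) \max_(y : T) dist x y.

Definition distance_regular : Prop :=
  connected /\
  exists c a b : nat -> nat, forall v w : T,
    let i := dist v w in
    [/\ #|[set u | e w u & (dist v u).+1 == i]| = c i,
        #|[set u | e w u & dist v u == i]| = a i &
        #|[set u | e w u & dist v u == i.+1]| = b i].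

Definition bipartite : Prop :=
  exists f : T -> bool, forall x y, e x y -> f x != f y.

Definition dist_graph (i : nat) : rel T := fun x y => dist x y == i.

Definition primitive : Prop :=
  forall i, 1 <= i <= diam -> forall x y : T, connect (dist_graph i) x y.

Definition automorphism (s : {perm T}) : Prop :=
  forall x y, e (s x) (s y) = e x y.

End Graph.

(* The halved graph of X containing vertex v0: vertices are those at even
   distance from v0 (the colour class of v0), adjacency = distance 2 in X. *)
Definition halfV (T : finType) (e : rel T) (v0 : T) :=
  {x : T | ~~ odd (dist e v0 x)}.

Definition halved (T : finType) (e : rel T) (v0 : T) : rel (halfV e v0) :=
  fun x y => dist e (val x) (val y) == 2.
Arguments halved {T} e v0 _ _.
Arguments dist {T} e x y.
Arguments walk {T} e k x y.
Arguments dist_graph {T} e i x y.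

(* Main.v *)
(** For vertices x, y let D(x,y) be the number of z with dist(x,z) <> dist(y,z);
    it depends only on dist(x,y).  An automorphism s moving x to y moves at least
    D(x,y) vertices, and all vertices if it swaps the colour classes.  Otherwise
    put mu = #moved vertices, x moved in the colour class of the primitive halved
    graph, of size m = n/2.  Connectivity of the distance-dist(x, s x) graph on
    that class gives D <= E := (d+1) mu for all pairs of the class, and averaging
    D over these pairs yields an even and an odd i with sphere sizes k_i >= m - E.
    If 5E > m we are done.  If not, unimodality of the sphere sizes makes the two
    indices consecutive, p and p+1; p <= 1 is impossible because two vertices at
    distance 4 have disjoint neighbourhoods, so 2k <= m.  For p >= 2, the sphere
    of radius p-1 has at most E points, whence c_2 <= c_p <= k/4.  A moved vertex
    has at most c_2 fixed neighbours, so the moved points at distance j from x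
    number at least k_j / 2^j for j <= p, and mu >= k_p / 2^p. *)

Require Import Defs.
From HB Require Import structures.
From mathcomp Require Import all_boot all_order all_algebra all_fingroup.
From mathcomp Require Import zify.
Import GRing.Theory Num.Theory.
Local Open Scope ring_scope.

Set Implicit Arguments. Unset Strict Implicit. Unset Printing Implicit Defensive.

(** * Walks and graph distance *)

Section Walk.
Local Open Scope nat_scope.
Variables (T : finType) (e : rel T).

Lemma walkP k x y :
  reflect (exists p, [/\ path e x p, size p = k & last x p = y]) (walk e k x y).
Proof.
elim: k x => [|k IH] x /=.
  apply: (iffP eqP) => [->|[p [_ /size0nil -> //]]].
  by exists [::].
apply: (iffP existsP) => [[z /andP[exz /IH[p [pp sp lp]]]]|[[|z p] [//= /andP[exz pp] [sp] lp]]].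
  by exists (z :: p); rewrite /= exz sp.
by exists z; rewrite exz; apply/IH; exists p.
Qed.

Lemma walk_cat k l x y z : walk e k x y -> walk e l y z -> walk e (k + l) x z.
Proof.
move=> /walkP[p [pp sp lp]] /walkP[q [pq sq lq]].
by apply/walkP; exists (p ++ q); rewrite cat_path size_cat last_cat lp pp pq sp sq.
Qed.

Lemma walk_sym k x y : symmetric e -> walk e k x y -> walk e k y x.
Proof.
move=> es; elim: k x => [|k IH] x /=; first by rewrite eq_sym.
case/existsP=> z /andP[exz /IH w].
have w1 : walk e 1 z x by apply/existsP; exists x; rewrite es exz /=.
by have := walk_cat w w1; rewrite addn1.
Qed.

Lemma walk_split k l x y : walk e (k + l) x y -> exists2 z, walk e k x z & walk e l z y.
Proof.
elim: k x => [|k IH] x /=; first by exists x.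
case/existsP=> z /andP[exz /IH[u wk wl]]; exists u => //.
by apply/existsP; exists z; rewrite exz.
Qed.

(** Cutting out cycles brings the length below [#|T|], into the range that [dist] searches. *)
Lemma walk_shorten k x y : walk e k x y -> exists2 l, l < #|T| /\ l <= k & walk e l x y.
Proof.
case/walkP=> p [pp sp lp]; move: lp; case/shortenP: pp => q pq uq sq lq.
exists (size q); last by apply/walkP; exists q.
split; first by rewrite -[(size q).+1]/(size (x :: q)) -(card_uniqP uq) max_card.
by rewrite -sp; apply: uniq_leq_size sq; case/andP: uq.
Qed.

Lemma dist_walk k x y : walk e k x y -> walk e (dist e x y) x y.
Proof.
case/walk_shorten=> l [lT _] w.
have h : has (fun k => walk e k x y) (iota 0 #|T|).
  by apply/hasP; exists l; rewrite ?mem_iota.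
have := nth_find 0 h; rewrite nth_iota //.
by have := h; rewrite has_find size_iota.
Qed.

Lemma walk_dist k x y : walk e k x y -> dist e x y <= k.
Proof.
case/walk_shorten=> l [lT lk] w; apply: leq_trans lk; rewrite leqNgt.
by apply/negP=> /(before_find 0); rewrite nth_iota // add0n w.
Qed.

Lemma connect_walk x y : connect e x y -> exists k, walk e k x y.
Proof. by case/connectP=> p pp lp; exists (size p); apply/walkP; exists p. Qed.

Lemma dist_unique x y k : walk e k x y ->
  (forall l, walk e l x y -> k <= l) -> dist e x y = k.
Proof.
by move=> w h; apply/eqP; rewrite eqn_leq (walk_dist w) h //; apply: dist_walk w.
Qed.

Lemma dist_le_diam x y : dist e x y <= diam e.
Proof.
apply: leq_trans (leq_bigmax x).
exact: (leq_bigmax (F := fun y => dist e x y) y).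
Qed.

Hypotheses (e_sym : symmetric e) (e_irr : irreflexive e) (e_conn : connected e).

Lemma walk_of_dist x y : walk e (dist e x y) x y.
Proof. by case: (connect_walk (e_conn x y)) => k; apply: dist_walk. Qed.

Lemma dist_triangle y x z : dist e x z <= dist e x y + dist e y z.
Proof. by apply: walk_dist; apply: walk_cat; apply: walk_of_dist. Qed.

Lemma dist_sym x y : dist e x y = dist e y x.
Proof.
by apply/eqP; rewrite eqn_leq !walk_dist //; apply: (walk_sym e_sym);
  apply: walk_of_dist.
Qed.

Lemma dist_eq0 x y : (dist e x y == 0) = (x == y).
Proof.
apply/idP/idP => [/eqP h|h]; first by have := walk_of_dist x y; rewrite h.
by rewrite -leqn0; apply: walk_dist.
Qed.

Lemma distxx x : dist e x x = 0.
Proof. by apply/eqP; rewrite dist_eq0. Qed.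

Lemma dist_eq1 x y : (dist e x y == 1) = e x y.
Proof.
apply/idP/idP => [/eqP h|h].
  have := walk_of_dist x y; rewrite h /= => /existsP[z /andP[exz /eqP <-]] //.
rewrite eqn_leq walk_dist /=; last by apply/existsP; exists y; rewrite h /=.
by rewrite lt0n dist_eq0; apply: contraL h => /eqP->; rewrite e_irr.
Qed.

Lemma dist_adj x y z : e y z -> dist e x z <= (dist e x y).+1.
Proof. by rewrite -dist_eq1 => /eqP h; rewrite -addn1 -h dist_triangle. Qed.

Lemma geodesic x y i : i <= dist e x y ->
  exists2 z, dist e x z = i & dist e z y = dist e x y - i.
Proof.
move=> le_i; have := walk_of_dist x y; rewrite -{1}(subnKC le_i).
case/walk_split=> z w1 w2; exists z; have := dist_triangle z x y;
  have := walk_dist w1; have := walk_dist w2; lia.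
Qed.

Lemma diam_attained i : 0 < #|T| -> i <= diam e -> exists x y, dist e x y = i.
Proof.
move=> T0 le_i.
have [x hx] := eq_bigmax (fun x => \max_y dist e x y) T0.
have [y hy] := eq_bigmax (fun y => dist e x y) T0.
have hd : diam e = dist e x y by rewrite /diam hx hy.
by rewrite hd in le_i; have [z <- _] := geodesic le_i; exists x, z.
Qed.

End Walk.

Section Counting.
Local Open Scope nat_scope.
Variables (T : finType) (e : rel T).

Lemma double_count_edges (A B : pred T) : symmetric e ->
  \sum_(w | A w) #|[set z | e w z & B z]| = \sum_(z | B z) #|[set w | e z w & A w]|.
Proof.
move=> es.
have E (C : pred T) w : #|[set z | e w z & C z]| = \sum_(z | C z) e w z.
  rewrite -sum1_card [RHS]big_mkcond [LHS]big_mkcond; apply: eq_bigr => z _.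
  by rewrite inE; case: (e w z) (C z) => [] [].
under eq_bigr do rewrite E; under [RHS]eq_bigr do rewrite E.
by rewrite exchange_big; apply: eq_bigr => z _; apply: eq_bigr => w _; rewrite es.
Qed.

End Counting.

(** * Parity of distances and monotonicity of the parameters b and c *)

Section BipartiteDistanceRegular.
Local Open Scope nat_scope.
Variables (T : finType) (e : rel T) (col : T -> bool) (b c : nat -> nat).
Hypotheses (e_sym : symmetric e) (e_irr : irreflexive e) (e_conn : connected e).
Hypothesis e_col : forall x y, e x y -> col x != col y.
Hypothesis c_eq : forall v w,
  #|[set u | e w u & (dist e v u).+1 == dist e v w]| = c (dist e v w).
Hypothesis b_eq : forall v w,
  #|[set u | e w u & dist e v u == (dist e v w).+1]| = b (dist e v w).

Let dist_triangle := dist_triangle e_conn.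
Let dist_sym := dist_sym e_sym e_conn.
Let distxx := distxx e_conn.
Let dist_eq0 := dist_eq0 e_conn.
Let dist_eq1 := dist_eq1 e_irr e_conn.

Lemma odd_dist x y : odd (dist e x y) = (col x != col y).
Proof.
have : walk e (dist e x y) x y by apply: walk_of_dist.
move: (dist e x y) => k; elim: k x => [|k IH] x /=; first by move/eqP->; rewrite eqxx.
case/existsP=> z /andP[/e_col h /IH ->]; move: h.
by case: (col x) (col y) (col z) => [] [] [].
Qed.

Lemma odd_distD x y z : odd (dist e x z) = odd (dist e x y) (+) odd (dist e y z).
Proof. by rewrite !odd_dist; case: (col x) (col y) (col z) => [] [] []. Qed.

Lemma dist_adjE x y z : e y z ->
  dist e x z = (dist e x y).+1 \/ dist e x y = (dist e x z).+1.
Proof.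
move=> eyz; have ezy : e z y by rewrite e_sym.
have h1 := dist_adj e_irr e_conn x eyz; have h2 := dist_adj e_irr e_conn x ezy.
have := odd_distD x y z; have -> : dist e y z = 1 by apply/eqP; rewrite dist_eq1.
case: (ltngtP (dist e x z) (dist e x y)) => h; [by right; lia|by left; lia|].
by rewrite h; case: odd.
Qed.

Lemma card_nbhd w : #|[set u | e w u]| = b 0.
Proof.
rewrite -(distxx w) -b_eq distxx; apply: eq_card => u.
by rewrite !inE dist_eq1 andbb.
Qed.

(** Entry of the tridiagonal intersection matrix; it is 0 at [j = i] because adjacent vertices have
    different colours. *)
Definition nbr_count i j := if j.+1 == i then c i else if j == i.+1 then b i else 0.

Lemma card_nbhd_sphere v w j :
  #|[set u | e w u & dist e v u == j]| = nbr_count (dist e v w) j.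
Proof.
rewrite /nbr_count; case: eqP => [h|h1].
  by rewrite -c_eq; apply: eq_card => u; rewrite !inE -h eqSS.
case: eqP => [h|h2]; first by rewrite -b_eq; apply: eq_card => u; rewrite !inE h.
apply: eq_card0 => u; rewrite !inE; apply/negP=> /andP[/(dist_adjE v) h /eqP hj].
by case: h; rewrite hj => h; [apply: h2|apply: h1].
Qed.

Lemma b_plus_c i : i <= diam e -> 0 < #|T| -> b i + c i = b 0.
Proof.
move=> le_i T0; have [v [w <-]] := diam_attained e_conn T0 le_i.
rewrite -b_eq -c_eq -(card_nbhd w) -cardsUI [X in _ + X]eq_card0 => [|u].
  rewrite addn0; apply: eq_card => u; rewrite !inE -andb_orr.
  case ewu: (e w u) => //=.
  by case: (dist_adjE v ewu) => ->; rewrite eqxx ?orbT.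
rewrite !inE; apply/negP=> /andP[/andP[_ /eqP ->]] /andP[_ /eqP]; lia.
Qed.

Lemma c_gt0 i : 0 < i <= diam e -> 0 < #|T| -> 0 < c i.
Proof.
case/andP=> i0 le_i T0; have [v [w hi]] := diam_attained e_conn T0 le_i.
have /(geodesic e_conn)[z h1 h2] : i.-1 <= dist e v w by rewrite hi leq_pred.
rewrite -hi -c_eq; apply/card_gt0P; exists z; rewrite inE h1 hi prednK // eqxx.
rewrite e_sym -dist_eq1 h2; lia.
Qed.

(** For v, w at distance i+1, let z be the neighbour of v on a geodesic to w. A neighbour of w that
    is closer to z than w is also closer to v. *)
Lemma c_leS i : i < diam e -> 0 < #|T| -> c i <= c i.+1.
Proof.
move=> lt_i T0; have [v [w hi]] := diam_attained e_conn T0 lt_i.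
have /(geodesic e_conn)[z h1 h2] : 1 <= dist e v w by rewrite hi.
have {}h2 : dist e z w = i by rewrite h2 hi subn1.
rewrite -hi -{1}h2 -!c_eq; apply/subset_leq_card/subsetP=> u; rewrite !inE.
case/andP=> ewu; rewrite ewu /= => /eqP h3.
have := dist_triangle z v u; case: (dist_adjE v ewu); lia.
Qed.

Lemma c_le i j : i <= j -> j <= diam e -> 0 < #|T| -> c i <= c j.
Proof.
move=> le_ij; rewrite -(subnKC le_ij); elim: (j - i) => [|l IH] h T0; rewrite ?addn0 //.
by rewrite addnS in h *; apply: leq_trans (IH (ltnW h) T0) (c_leS h T0).
Qed.

Lemma b_ge i j : i <= j -> j <= diam e -> 0 < #|T| -> b j <= b i.
Proof.
move=> ij jd T0; have := c_le ij jd T0; have := b_plus_c jd T0.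
have := b_plus_c (leq_trans ij jd) T0; lia.
Qed.

(** * Intersection numbers p^h_{ij}, where h = dist(x, y) *)

Definition inum i j x y := #|[set z | dist e x z == i & dist e y z == j]|.

Lemma sum_by_dist (A : pred T) (g : nat -> nat) y :
  \sum_(w | A w) g (dist e y w) =
  \sum_(l < (diam e).+1) #|[set w | A w & dist e y w == l]| * g l.
Proof.
rewrite (partition_big (fun w => inord (dist e y w) : 'I_(diam e).+1) predT) //=.
apply: eq_bigr => l _.
have E w : (inord (dist e y w) == l) = (dist e y w == l).
  by rewrite -val_eqE /= inordK // ltnS dist_le_diam.
rewrite -sum_nat_const; apply: eq_big => w; rewrite ?inE E //.
by case/andP=> _ /eqP->.
Qed.

(** Both sides count the edges between the i-sphere around x and the j-sphere around y. *)
Lemma inum_rec i j x y :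
  \sum_(l < (diam e).+1) inum i l x y * nbr_count l j =
  \sum_(l < (diam e).+1) inum l j x y * nbr_count l i.
Proof.
have := double_count_edges (fun w => dist e x w == i) (fun z => dist e y z == j) e_sym.
under eq_bigr do rewrite card_nbhd_sphere.
under [in RHS]eq_bigr do rewrite card_nbhd_sphere.
rewrite (sum_by_dist _ (nbr_count^~ j)) (sum_by_dist _ (nbr_count^~ i)) => ->.
apply: eq_bigr => l _; congr (_ * _); apply: eq_card => z.
by rewrite !inE andbC.
Qed.

(* Induction on [i]: [inum_rec] determines [c i.+1 * inum i.+1 j] from smaller [i]. *)
Lemma inum_dist i j x y x' y' : dist e x y = dist e x' y' ->
  inum i j x y = inum i j x' y'.
Proof.
move=> hd; have T0 : 0 < #|T| by apply/card_gt0P; exists x.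
elim/ltn_ind: i j => -[_|i IH] j.
  have E u v : inum 0 j u v = (dist e u v == j).
    rewrite /inum; case: eqP => h.
      rewrite -[RHS](cards1 u); apply: eq_card => z.
      by rewrite !inE dist_eq0 eq_sym; case: eqP => // ->; rewrite dist_sym h eqxx.
    apply: eq_card0 => z; rewrite !inE dist_eq0; case: eqP => // <-.
    by rewrite dist_sym; apply/eqP.
  by rewrite !E hd.
have [le_i|gt_i] := leqP i.+1 (diam e); last first.
  by rewrite /inum !eq_card0 // => z; rewrite !inE; apply/negP=> /andP[/eqP h _];
    have := dist_le_diam e x z; have := dist_le_diam e x' z; lia.
have io : i.+1 < (diam e).+1 by [].
have := inum_rec i j x y; rewrite (eq_bigr (fun l : 'I__ => inum i l x' y' * nbr_count l j));
  last by move=> l _; rewrite IH.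
rewrite inum_rec (bigD1 (Ordinal io)) //= [in RHS](bigD1 (Ordinal io)) //=.
rewrite [X in _ = _ + X](eq_bigr (fun l : 'I__ => inum l j x' y' * nbr_count l i)).
  move/addIn/eqP; rewrite eqn_pmul2r; first by move/eqP.
  by rewrite /nbr_count eqxx c_gt0.
move=> l; rewrite -val_eqE /= => hl.
(* Induction covers [l <= i]; for [l > i.+1] the coefficient vanishes, so only the term [i.+1] is
   left. *)
have [le_l|gt_l] := leqP l i; first by rewrite IH.
by rewrite /nbr_count eq_sym (negPf hl) ltn_eqF ?muln0 //; lia.
Qed.

(** * Sizes of spheres and colour classes *)

Definition sphere x i := [set z | dist e x z == i].

Lemma card_sphere u v i : #|sphere u i| = #|sphere v i|.
Proof.
have E w : #|sphere w i| = inum i i w w.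
  by apply: eq_card => z; rewrite !inE andbb.
by rewrite !E; apply: inum_dist; rewrite !distxx.
Qed.

Lemma card_sphereS v i : #|sphere v i| * b i = #|sphere v i.+1| * c i.+1.
Proof.
have := double_count_edges (fun w => dist e v w == i) (fun z => dist e v z == i.+1) e_sym.
rewrite (eq_bigr (fun=> b i)) => [|w /eqP hw]; last first.
  by rewrite card_nbhd_sphere hw /nbr_count gtn_eqF // eqxx.
rewrite [in RHS](eq_bigr (fun=> c i.+1)) => [|w /eqP hw]; last first.
  by rewrite card_nbhd_sphere hw /nbr_count eqxx.
by rewrite !sum_nat_const /sphere !cardsE.
Qed.

Definition half v := [set y | ~~ odd (dist e v y)].

Lemma card_half u v : #|half u| = #|half v|.
Proof.
have E w : #|half w| = \sum_(l < (diam e).+1) #|sphere w l| * ~~ odd l.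
  rewrite -sum1_card big_mkcond /=.
  rewrite (eq_bigr (fun y => (~~ odd (dist e w y) : nat))); last first.
    by move=> y _; rewrite inE; case: odd.
  by rewrite (sum_by_dist _ (fun l => (~~ odd l : nat))).
by rewrite !E; apply: eq_bigr => l _; rewrite (card_sphere u v).
Qed.

Lemma b0_gt0 : 0 < diam e -> 0 < #|T| -> 0 < b 0.
Proof.
by move=> d0 T0; rewrite -(b_plus_c d0 T0) addn_gt0 c_gt0 ?orbT.
Qed.

(** The complement is the class of any neighbour of v, and [card_half] applies to it. *)
Lemma card_halfC v : 0 < diam e -> #|~: half v| = #|half v|.
Proof.
move=> d0; have T0 : 0 < #|T| by apply/card_gt0P; exists v.
have := b0_gt0 d0 T0; rewrite -(card_nbhd v) => /card_gt0P[u].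
rewrite inE -dist_eq1 => /eqP hu.
rewrite (card_half v u); apply: eq_card => y; rewrite !inE negbK (odd_distD v u y) hu.
by rewrite addTb.
Qed.

Lemma sphere_half v i : ~~ odd i -> sphere v i \subset half v.
Proof. by move=> hi; apply/subsetP=> z; rewrite !inE => /eqP->. Qed.

Lemma sphere_halfC v i : odd i -> sphere v i \subset ~: half v.
Proof. by move=> hi; apply/subsetP=> z; rewrite !inE => /eqP->; rewrite negbK. Qed.

Lemma card_sphere2_le v i j : 0 < diam e -> odd i = odd j -> i != j ->
  #|sphere v i| + #|sphere v j| <= #|half v|.
Proof.
move=> d0 hij nij.
rewrite -cardsUI [X in _ + X]eq_card0 ?addn0 => [|z]; last first.
  by rewrite !inE; apply/negP=> /andP[/eqP-> /eqP h]; rewrite h eqxx in nij.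
case: (boolP (odd j)) hij => hj hi.
  by rewrite -(card_halfC v d0) subset_leq_card // subUset !sphere_halfC.
by rewrite subset_leq_card // subUset !sphere_half // hi.
Qed.

(** * The number [dsep x y] of points separating x from y, written D(x,y) in the overview *)

Definition dsep x y := #|[set z | dist e x z != dist e y z]|.

(** The points that do not separate the pair number the sum of all [inum l l]. *)
Lemma dsep_dist x y x' y' : dist e x y = dist e x' y' -> dsep x y = dsep x' y'.
Proof.
move=> hd.
have E u v : #|[set z | dist e u z == dist e v z]| = \sum_(l < (diam e).+1) inum l l u v.
  rewrite -sum1_card (sum_by_dist _ (fun=> 1) u); apply: eq_bigr => l _; rewrite muln1.
  apply: eq_card => z; rewrite !inE [LHS]andbC; case: eqP => //= ->.
  by rewrite eq_sym.
have F u v : dsep u v = #|T| - #|[set z | dist e u z == dist e v z]|.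
  by rewrite /dsep cardsCs; congr (_ - _); apply: eq_card => z; rewrite !inE negbK.
rewrite !F !E; congr (_ - _); apply: eq_bigr => l _; exact: inum_dist.
Qed.

Lemma dsep_triangle y x z : dsep x z <= dsep x y + dsep y z.
Proof.
apply: leq_trans (leq_card_setU _ _); apply/subset_leq_card/subsetP=> u; rewrite !inE.
by rewrite -negb_and; apply: contra => /andP[/eqP->].
Qed.

(* The values of [dsep x] on the class of [v0] leave no gap longer than [delta]:
   otherwise the points below the gap would form a union of components of the
   distance-[r] graph. There are at most [diam + 1] values, one per distance. *)
Lemma dsep_le v0 r delta :
  (forall P : pred T, (forall u w, u \in half v0 -> w \in half v0 ->
      dist e u w = r -> P u -> P w) ->
    forall x y, x \in half v0 -> y \in half v0 -> P x -> P y) ->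
  (forall u w, dist e u w = r -> dsep u w <= delta) ->
  forall x y, x \in half v0 -> y \in half v0 -> dsep x y <= (diam e).+1 * delta.
Proof.
move=> conn_r dr x y hx hy.
pose R t := [set l : 'I_(diam e).+1 | [exists y,
  [&& y \in half v0, dist e x y == l & dsep x y <= t * delta]]].
(* At t = d+1 the second alternative fails, as only d+1 distances exist. *)
suff H t : [forall y in half v0, dsep x y <= t * delta] \/ t < #|R t|.
  case: (H (diam e).+1) => [/forall_inP/(_ _ hy) //|].
  by move=> /leq_trans/(_ (max_card _)); rewrite card_ord ltnn.
elim: t => [|t IH].
  right; apply/card_gt0P; exists ord0; rewrite inE; apply/existsP; exists x.
  rewrite hx distxx eqxx /= leqn0 cards_eq0; apply/eqP/setP=> z.
  by rewrite !inE eqxx.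
have sub : R t \subset R t.+1.
  apply/subsetP=> l; rewrite !inE => /existsP[z /and3P[h1 h2 h3]].
  by apply/existsP; exists z; rewrite h1 h2 mulSn (leq_trans h3) // leq_addl.
case: IH => [/forall_inP h|lt_t].
  left; apply/forall_inP=> z hz; rewrite mulSn; apply: leq_trans (leq_addl _ _).
  exact: h.
have [sub'|nsub] := boolP (R t.+1 \subset R t); last first.
  right; apply: leq_ltn_trans lt_t _; apply: proper_card; by rewrite properE sub.
left; apply/forall_inP=> z hz; rewrite mulSn; apply: leq_trans (leq_addl _ _).
(* When [R] stops growing, the bound passes from u to w: the distance of w from x is already in
   [R t], and [dsep] depends on that distance alone. *)
apply: (conn_r (fun z => dsep x z <= t * delta) _ x z hx hz) => [u w hu hw huw le_u|].
  have : inord (dist e x w) \in R t.+1.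
    rewrite inE; apply/existsP; exists w.
    rewrite hw inordK ?ltnS ?dist_le_diam // eqxx /= mulSnr.
    by apply: leq_trans (dsep_triangle u x w) _; rewrite leq_add // dr.
  move/(subsetP sub'); rewrite inE => /existsP[w' /and3P[_ /eqP h]].
  by rewrite inordK ?ltnS ?dist_le_diam // in h; rewrite (dsep_dist h).
by rewrite /dsep eq_card0 // => u; rewrite !inE eqxx.
Qed.

(* If every sphere of this parity were smaller, the average of [dsep] over the
   pairs of [half v0] would exceed [E]. *)
Lemma dominant_sphere v0 E (odd_i : bool) : 0 < diam e ->
  (forall x y, x \in half v0 -> y \in half v0 -> dsep x y <= E) ->
  exists2 i, odd i = odd_i & #|half v0| <= #|sphere v0 i| + E.
Proof.
move=> d0 hE; pose m := #|half v0|.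
pose C := [set z | odd (dist e v0 z) == odd_i].
have m0 : 0 < m by apply/card_gt0P; exists v0; rewrite inE distxx.
have cC : #|C| = m.
  case: odd_i @C => C; last by apply: eq_card => z; rewrite !inE; case: odd.
  by rewrite /m -card_halfC //; apply: eq_card => z; rewrite !inE; case: odd.
have [h|h] := boolP [forall z in C, forall x in half v0,
    #|sphere v0 (dist e z x)| + E < m]; last first.
  case/forall_inPn: h => z hz /forall_inPn[x hx]; rewrite -leqNgt => h.
  exists (dist e z x) => //; move: hz hx; rewrite !inE => /eqP<-.
  by rewrite (odd_distD v0 z x); case: (odd (dist e v0 z)) (odd (dist e z x)) => [] [].
have up : \sum_(x in half v0) \sum_(y in half v0)
    \sum_(z in C) (dist e x z != dist e y z) <= m * (m * E).
  rewrite /m -!sum_nat_const; apply: leq_sum => x hx.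
  apply: leq_sum => y hy; apply: leq_trans (hE _ _ hx hy).
  rewrite /dsep -sum1_card big_mkcond [X in _ <= X]big_mkcond /=.
  by apply: leq_sum => z _; rewrite [_ \in [set _ | _ != _]]inE; case: ifP => //; case: (_ != _).
(* Fix x and z: every y of the class off the sphere around z through x is separated from x by z, and
   there are more than E such y. *)
have lo : m * (m * E.+1) <= \sum_(x in half v0) \sum_(y in half v0)
    \sum_(z in C) (dist e x z != dist e y z).
  rewrite /m -sum_nat_const; apply: leq_sum => x hx.
  rewrite exchange_big /= -/m -cC -sum_nat_const; apply: leq_sum => z hz.
  have := forall_inP (forall_inP h _ hz) _ hx; rewrite (card_sphere v0 z) => hs.
  have : m <= #|sphere z (dist e z x)| + \sum_(y in half v0) (dist e x z != dist e y z).
    rewrite /m -!sum1_card [X in _ <= X + _]big_mkcond [X in _ <= _ + X]big_mkcond.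
    rewrite -big_split [X in X <= _]big_mkcond /=; apply: leq_sum => y _; rewrite [y \in sphere _ _]inE ![dist e _ z]dist_sym eq_sym.
    by case: (y \in half v0) => //; case: eqP.
  lia.
have := leq_trans lo up; rewrite !leq_pmul2l // ltnn //.
Qed.

(** * Valency bound and unimodality of sphere sizes *)

Lemma card_sphere_gt0 v i : i <= diam e -> 0 < #|sphere v i|.
Proof.
move=> le_i; have T0 : 0 < #|T| by apply/card_gt0P; exists v.
have [x [y h]] := diam_attained e_conn T0 le_i.
by rewrite (card_sphere v x); apply/card_gt0P; exists y; rewrite inE h.
Qed.

Lemma sphere_gt0_le_diam v i : 0 < #|sphere v i| -> i <= diam e.
Proof. by case/card_gt0P=> z; rewrite inE => /eqP<-; apply: dist_le_diam. Qed.

Lemma b_gt0 i : i < diam e -> 0 < #|T| -> 0 < b i.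
Proof.
move=> lt_i /card_gt0P[v _]; have T0 : 0 < #|T| by apply/card_gt0P; exists v.
have : 0 < #|sphere v i| * b i by rewrite card_sphereS muln_gt0 card_sphere_gt0 // c_gt0.
by rewrite muln_gt0 => /andP[].
Qed.

Lemma card_sphere1 v : #|sphere v 1| = b 0.
Proof. by rewrite -(card_nbhd v); apply: eq_card => z; rewrite !inE dist_eq1. Qed.

Lemma valency_le v : 4 <= diam e -> 2 * b 0 <= #|half v|.
Proof.
move=> d4; have T0 : 0 < #|T| by apply/card_gt0P; exists v.
have [x [y h]] := diam_attained e_conn T0 d4.
rewrite (card_half v x) -card_halfC; last by lia.
rewrite mul2n -addnn -{1}(card_sphere1 x) -(card_sphere1 y) -cardsUI.
rewrite [X in _ + X]eq_card0 => [|z]; last first.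
  rewrite !inE; apply/negP=> /andP[/eqP h1 /eqP h2].
  by have := dist_triangle z x y; rewrite h h1 dist_sym h2.
rewrite addn0; apply/subset_leq_card/subsetP=> z; rewrite !inE negbK.
by case/orP=> /eqP hz; [rewrite hz | rewrite (odd_distD x y) h hz].
Qed.

(* The sphere sizes are unimodal, and the sizes of the spheres of a given parity
   add up to [#|half v|]. *)
Lemma dominant_adjacent v E i j : i < j -> j <= diam e -> odd i != odd j ->
  2 * E < #|half v| -> #|half v| <= #|sphere v i| + E ->
  #|half v| <= #|sphere v j| + E -> j = i.+1.
Proof.
move=> ij jd oij hE hi hj; have T0 : 0 < #|T| by apply/card_gt0P; exists v.
have d0 : 0 < diam e by lia.
apply/eqP/negPn/negP=> nij.
have h1 : #|sphere v i.+1| + #|sphere v j| <= #|half v|.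
  by apply: card_sphere2_le; rewrite 1?eq_sym //=; case: odd oij => //; case: odd.
(* Spheres i+1 and j share a class, so k_{i+1} <= E < k_i, whereas [c i.+1 <= b i] would give k_i <=
   k_{i+1}. *)
have hb : b i < c i.+1.
  rewrite ltnNge; apply/negP=> hbc; have c0 : 0 < c i.+1 by apply: c_gt0; lia.
  have := card_sphereS v i; have : #|sphere v i.+1| < #|sphere v i| by lia.
  move: #|_| #|_| => A B; nia.
(* From i+1 on sizes cannot grow, so k_j <= k_{i+1} <= E, contradicting the size of sphere j. *)
have dec l : i.+1 + l <= diam e -> #|sphere v (i.+1 + l)| <= #|sphere v i.+1|.
  elim: l => [|l IH]; rewrite ?addn0 // addnS => hl.
  apply: leq_trans (IH (ltnW hl)).
  have c0 : 0 < c (i.+1 + l).+1 by apply: c_gt0.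
  rewrite -(leq_pmul2r c0) -card_sphereS leq_mul2l; apply/orP; right.
  have h2 : b (i.+1 + l) <= b i by apply: b_ge => //; lia.
  have h3 : c i.+1 <= c (i.+1 + l).+1 by apply: c_le => //; lia.
  lia.
have := dec (j - i.+1); rewrite subnKC // => /(_ jd); lia.
Qed.

(** * Automorphisms and their moved points *)

Variable s : {perm T}.
Hypothesis s_aut : automorphism e s.
Let M := [set x | s x != x].

Lemma walk_aut k x y : walk e k (s x) (s y) = walk e k x y.
Proof.
elim: k x => [|k IH] x /=; first by rewrite (inj_eq perm_inj).
apply/existsP/existsP=> -[z /andP[h1 h2]]; last by exists (s z); rewrite s_aut IH h1.
by exists (perm_inv s z); rewrite -s_aut -IH permKV h1.
Qed.

Lemma dist_aut x y : dist e (s x) (s y) = dist e x y.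
Proof. by apply: eq_find => k; apply: walk_aut. Qed.

(** A fixed point is equidistant from x and [s x]. *)
Lemma dsep_moved x : dsep x (s x) <= #|M|.
Proof.
apply/subset_leq_card/subsetP=> z; rewrite !inE; apply: contra => /eqP hz.
by rewrite -{2}hz dist_aut.
Qed.

(** A fixed neighbour of z is also adjacent to [s z]. If one exists, z and [s z] are at distance 2,
    with [c 2] common neighbours. *)
Lemma card_fixed_nbhd z : z \in M -> #|[set u | e z u & s u == u]| <= c 2.
Proof.
rewrite inE => hz; case: (set_0Vmem [set u | e z u & s u == u]) => [->|[u]].
  by rewrite cards0.
have adj w : e z w -> s w == w -> dist e (s z) w = 1.
  by move=> ezw /eqP sw; apply/eqP; rewrite dist_eq1 -sw s_aut.
rewrite inE => /andP[ezu su].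
have d2 : dist e (s z) z = 2.
  have h1 : dist e u z = 1 by apply/eqP; rewrite dist_eq1 e_sym.
  have := dist_triangle u (s z) z; have := odd_distD (s z) u z.
  move: hz; rewrite -dist_eq0 (adj u ezu su) h1.
  by case: (dist e (s z) z) => [|[|[|]]].
rewrite -d2 -c_eq; apply/subset_leq_card/subsetP=> w; rewrite !inE => /andP[ezw sw].
by rewrite ezw adj // d2.
Qed.

(* A moved vertex has at most [c 2] fixed neighbours, so the moved set expands
   along the spheres at half the rate of the whole graph at least. *)
Lemma moved_sphere_growth x p : x \in M -> p <= diam e ->
  (forall j, j < p -> 2 * c 2 <= b j) ->
  forall j, j <= p -> #|sphere x j| <= 2 ^ j * #|M :&: sphere x j|.
Proof.
move=> xM pd hb; have T0 : 0 < #|T| by apply/card_gt0P; exists x.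
elim=> [_|j IH jp].
  rewrite expn0 mul1n subset_leq_card //; apply/subsetP=> z; rewrite in_setI => hz.
  by rewrite hz andbT; move: hz; rewrite inE dist_eq0 => /eqP<-.
have {IH} := IH (ltnW jp) => IH.
have c0 : 0 < c j.+1 by apply: c_gt0 => //; lia.
have := double_count_edges (fun w => w \in M :&: sphere x j)
  (fun w => w \in M :&: sphere x j.+1) e_sym.
have lo w : w \in M :&: sphere x j -> b j <= 2 * #|[set z | e w z & z \in M :&: sphere x j.+1]|.
  rewrite in_setI => /andP[wM]; rewrite inE => /eqP hw.
  have := hb j jp; have := card_fixed_nbhd wM.
  have : b j <= #|[set u | e w u & s u == u]| + #|[set z | e w z & z \in M :&: sphere x j.+1]|.
    rewrite -hw -b_eq hw; apply: leq_trans (leq_card_setU _ _).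
    apply/subset_leq_card/subsetP=> u; rewrite !inE => /andP[-> ->] /=.
    by case: eqP.
  lia.
have up z : z \in M :&: sphere x j.+1 -> #|[set w | e z w & w \in M :&: sphere x j]| <= c j.+1.
  rewrite in_setI => /andP[_]; rewrite inE => /eqP hz; rewrite -hz -c_eq hz.
  apply/subset_leq_card/subsetP=> u; rewrite !inE eqSS.
  by case/andP=> -> /andP[_ ->].
have := leq_sum (index_enum T) up; have := leq_sum (index_enum T) lo; rewrite -big_distrr !sum_nat_const /=.
rewrite expnS; move=> h1 h2 h3; rewrite h3 in h1.
rewrite -(leq_pmul2r c0) -card_sphereS.
move: (\sum_(_ in _) _) h1 h2 => S h1 h2.
apply: (@leq_trans (2 ^ j * (#|M :&: sphere x j| * b j))); first by rewrite mulnA leq_mul2r IH orbT.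
rewrite [2 * _]mulnC -!mulnA leq_mul2l; apply/orP; right.
apply: leq_trans h1 _; by rewrite leq_mul2l h2.
Qed.

(** Primitivity is given for one class only. A moved vertex of the other class has at most
    [c 2 < b 0] fixed neighbours, so it has a moved one. *)
Lemma moved_in_half v0 : 4 <= diam e -> s != 1%g -> exists2 x, x \in half v0 & x \in M.
Proof.
move=> d4 s1; have T0 : 0 < #|T| by apply/card_gt0P; exists v0.
have [x xM] : exists x, x \in M.
  case: (set_0Vmem M) => [M0|[x xM]]; last by exists x.
  case/eqP: s1; apply/permP=> z; rewrite perm1; apply/eqP/negPn/negP=> hz.
  by have : z \in M by [rewrite inE]; rewrite M0 inE.
have [xh|xh] := boolP (x \in half v0); first by exists x.
have := card_fixed_nbhd xM => hf.
have := b_plus_c (ltnW (ltnW d4)) T0; have := b_gt0 (ltnW d4) T0 => h1 h2.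
have : ~~ ([set u | e x u] \subset [set u | e x u & s u == u]).
  apply/negP=> /subset_leq_card; rewrite card_nbhd; lia.
case/subsetPn=> u; rewrite !inE => exu; rewrite exu /= => hu; exists u; last by rewrite inE.
move: xh; rewrite !inE negbK (odd_distD v0 x u) => ->.
by rewrite -dist_eq1 in exu; rewrite (eqP exu).
Qed.

Lemma motion_dichotomy v0 x : 4 <= diam e -> x \in half v0 -> x \in M ->
  (forall P : pred T, (forall u w, u \in half v0 -> w \in half v0 ->
      dist e u w = dist e x (s x) -> P u -> P w) ->
    forall u w, u \in half v0 -> w \in half v0 -> P u -> P w) ->
  #|T| <= 10 * (diam e).+1 * #|M| \/ #|T| <= 2 ^ (diam e).+2 * #|M|.
Proof.
move=> d4 xh xM conn_r; have T0 : 0 < #|T| by apply/card_gt0P; exists x.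
have d0 : 0 < diam e by lia.
have M0 : 0 < #|M| by apply/card_gt0P; exists x.
have cT : #|T| = 2 * #|half v0|.
  by rewrite -(cardsC (half v0)) card_halfC // mul2n addnn.
set E := (diam e).+1 * #|M|.
have hE : forall u w, u \in half v0 -> w \in half v0 -> dsep u w <= E.
  by apply: dsep_le conn_r _ => u w /dsep_dist->; apply: dsep_moved.
have E0 : 0 < E by rewrite muln_gt0.
(* With n = 2m, the case m < 5E gives the factor 10. *)
have [lt5|le5] := ltnP #|half v0| (5 * E); first by left; rewrite cT; lia.
right; have [i oi hi] := dominant_sphere false d0 hE.
have [j oj hj] := dominant_sphere true d0 hE.
have di : i <= diam e by apply: (@sphere_gt0_le_diam v0); lia.
have dj : j <= diam e by apply: (@sphere_gt0_le_diam v0); lia.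
have [p [pd hp hp1]] : exists p, [/\ p < diam e, #|half v0| <= #|sphere v0 p| + E &
    #|half v0| <= #|sphere v0 p.+1| + E].
  have hE2 : 2 * E < #|half v0| by lia.
  case: (ltngtP i j) => ij; last by rewrite -ij oi in oj.
    have hij : odd i != odd j by rewrite oi oj.
    by have h := dominant_adjacent ij dj hij hE2 hi hj; exists i; rewrite -h.
  have hij : odd j != odd i by rewrite oi oj.
  by have h := dominant_adjacent ij di hij hE2 hj hi; exists j; rewrite -h.
have k2 := valency_le v0 d4; have s1 := card_sphere1 v0.
(* Otherwise p or p+1 is 1, and k_1 = b_0 <= m/2 is too small. *)
have p2 : 1 < p.
  by case: p {pd} hp hp1 => [|[|//]] hp hp1; rewrite s1 in hp hp1; lia.
have pp : p.-1.+1 = p by lia.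
(* Spheres p-1 and p+1 share a class, and the latter leaves at most E points. *)
have small : #|sphere v0 p.-1| <= E.
  have : #|sphere v0 p.-1| + #|sphere v0 p.+1| <= #|half v0|.
    by apply: card_sphere2_le => //; [rewrite -{2}pp /= negbK|apply/eqP; lia].
  lia.
(* In k_{p-1} b_{p-1} = k_p c_p, use k_{p-1} <= E and k_p >= m - E >= 4E. *)
have cp : 4 * c p <= b 0.
  have := card_sphereS v0 p.-1; rewrite pp => h.
  have bk : b p.-1 <= b 0 by apply: b_ge => //; lia.
  have h2 : #|sphere v0 p.-1| * b p.-1 <= E * b 0 by apply: leq_mul.
  have h3 : 4 * E * c p <= #|sphere v0 p| * c p by apply: leq_mul => //; lia.
  rewrite -(leq_pmul2l E0) mulnA [E * 4]mulnC; lia.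
(* Here b_j = b_0 - c_j >= 4 c_p - c_p >= 2 c_2. *)
have hb j' : j' < p -> 2 * c 2 <= b j'.
  move=> jp; have := b_plus_c (leq_trans (ltnW jp) (ltnW pd)) T0.
  have := c_le p2 (ltnW pd) T0; have := c_le (ltnW jp) (ltnW pd) T0; lia.
have := moved_sphere_growth xM (ltnW pd) hb (leqnn p).
rewrite (card_sphere x v0) => h.
have h1 : #|M :&: sphere x p| <= #|M| by rewrite subset_leq_card // subsetIl.
have h2 : 2 ^ p * #|M :&: sphere x p| <= 2 ^ diam e * #|M|.
  by rewrite leq_mul // leq_pexp2l // ltnW.
(* Since k_p >= m - E >= m/2, n = 2m <= 4 k_p; this 4 is the +2 in the exponent. *)
rewrite cT !expnS; lia.
Qed.

(** A fixed z would be equidistant from x and [s x], making their distance even. *)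
Lemma swap_moves_all x : odd (dist e x (s x)) -> #|M| = #|T|.
Proof.
move=> hx; apply: eq_card => z; rewrite !inE; apply/negP=> /eqP hz.
by have := odd_distD x z (s x); rewrite -{2}hz dist_aut hx (dist_sym x z) addbb.
Qed.

(** * Distances in the halved graph and use of primitivity *)

Lemma dist_halved v0 (u w : halfV e v0) :
  dist (halved e v0) u w = (dist e (val u) (val w))./2.
Proof.
have ev (a : halfV e v0) z : odd (dist e (val a) z) = odd (dist e v0 z).
  by rewrite (odd_distD v0 (val a) z) (negPf (valP a)).
apply: dist_unique => [|l].
  have [k hk] : exists k, dist e (val u) (val w) = k.*2.
    exists (dist e (val u) (val w))./2.
    by rewrite -[LHS]odd_double_half ev (negPf (valP w)).
  rewrite hk doubleK.
  (* Every second vertex of a geodesic in [e] gives a walk in the halved graph. *)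
  elim: k u hk => [|k IH] u hk /=.
    by rewrite -val_eqE -dist_eq0 hk.
  have /(geodesic e_conn)[z h1 h2] : 2 <= dist e (val u) (val w) by rewrite hk.
  have hz : ~~ odd (dist e v0 z) by rewrite -(ev u) h1.
  apply/existsP; exists (Sub z hz); rewrite /halved SubK h1 eqxx IH //.
  by rewrite SubK h2 hk doubleS !subSS subn0.
move=> hw; suff : dist e (val u) (val w) <= l.*2 by lia.
elim: l u hw => [|l IH] u /=; first by move/eqP->; rewrite distxx.
case/existsP=> z /andP[/eqP h1 /IH h2]; rewrite doubleS -addn2 addnC.
by apply: leq_trans (dist_triangle (val z) _ _) _; rewrite h1 leq_add2l.
Qed.

(** Transfers primitivity from the subtype to X: connectivity of a distance graph becomes
    propagation of predicates, the form [dsep_le] takes. *)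
Lemma primitive_halved_closed v0 x y (P : pred T) : primitive (halved e v0) ->
  x \in half v0 -> y \in half v0 -> x != y ->
  (forall u w, u \in half v0 -> w \in half v0 ->
      dist e u w = dist e x y -> P u -> P w) ->
  forall u w, u \in half v0 -> w \in half v0 -> P u -> P w.
Proof.
move=> prim hx hy nxy Pcl u w hu hw.
rewrite !inE in hx hy hu hw.
have ev (f g : halfV e v0) : odd (dist e (val f) (val g)) = false.
  by apply/negP=> h; have := odd_distD v0 (val f) (val g);
    rewrite h (negPf (valP f)) (negPf (valP g)).
pose X : halfV e v0 := Sub x hx; pose Y : halfV e v0 := Sub y hy.
have r0 : 1 <= dist (halved e v0) X Y <= diam (halved e v0).
  rewrite dist_le_diam andbT dist_halved !SubK.
  have := ev X Y; rewrite !SubK; move: nxy; rewrite -dist_eq0.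
  by case: (dist e x y) => [|[|]].
have /connectP[q] := prim _ r0 (Sub u hu) (Sub w hw).
rewrite -[P w]/(P (val (Sub w hw : halfV e v0))) -[P u]/(P (val (Sub u hu : halfV e v0))).
move: (Sub u hu) (Sub w hw) => U W pq ->.
elim: q U pq => //= z q IH U /andP[/eqP hz pq] PU; apply: IH => //.
apply: Pcl PU; rewrite ?inE ?(valP U) ?(valP z) //.
(* Both distances are even, so equal halves mean equal distances. *)
move: hz; rewrite !dist_halved !SubK => /(congr1 double).
by have := odd_double_half (dist e (val U) (val z)); have := odd_double_half (dist e x y);
  have := ev X Y; rewrite !SubK ev => ->; rewrite !add0n => -> ->.
Qed.

End BipartiteDistanceRegular.

(** * Numerical bounds for the two factors of [motion_dichotomy], and the conclusion *)

Lemma motion_constant d : (4 <= d)%N ->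
  (10 * d.+1 <= (2 * d) ^ (2 * d + 5))%N /\ (2 ^ d.+2 <= (2 * d) ^ (2 * d + 5))%N.
Proof.
move=> d4; split.
  apply: (@leq_trans ((2 * d) ^ 3)%N); last by rewrite leq_pexp2l //; lia.
  by rewrite !expnS expn0; nia.
by apply: (@leq_trans ((2 * d) ^ d.+2)%N); [rewrite leq_exp2r //|rewrite leq_pexp2l //]; lia.
Qed.

Unset Implicit Arguments.

(* motion(X) >= (2d)^(-2d-5) n, i.e. every non-identity automorphism moves
   at least n / (2d)^(2d+5) vertices *)
Theorem theorem5p4 (T : finType) (e : rel T) (d : nat) :
  symmetric e -> irreflexive e ->
  distance_regular e -> bipartite e ->
  diam e = d -> (4 <= d)%N ->
  (exists v0 : T, primitive (halved e v0)) ->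
  forall s : {perm T}, automorphism e s -> s != 1%g ->
    (#|T|%:R / ((2 * d)%:R ^+ (2 * d + 5)) <= #|[set x | s x != x]|%:R :> rat).
Proof.
move=> e_sym e_irr [e_conn [c [a [b drg]]]] [col e_col] dd d4 [v0 prim] s s_aut s1.
have c_eq v w := let: And3 h _ _ := drg v w in h.
have b_eq v w := let: And3 _ _ h := drg v w in h.
have [k1 k2] := motion_constant d4.
have d2 : (0 < 2 * d)%N by lia.
rewrite -natrX ler_pdivrMr ?ltr0n ?expn_gt0 ?d2 // -natrM ler_nat mulnC.
move: d4 k1 k2; rewrite -dd => d4 k1 k2.
have [x xh xM] := moved_in_half e_sym e_irr e_conn e_col c_eq b_eq s_aut v0 d4 s1.
have [sw|nsw] := boolP (odd (dist e x (s x))).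
  rewrite (swap_moves_all e_sym e_conn e_col s_aut sw) leq_pmull // expn_gt0; lia.
have sxh : s x \in half e v0.
  by move: xh nsw; rewrite !inE (odd_distD e_conn e_col v0 x (s x)); case: odd.
have nx : x != s x by move: xM; rewrite inE eq_sym.
have conn_r P := primitive_halved_closed e_conn e_col (P := P) prim xh sxh nx.
have [h|h] := motion_dichotomy e_sym e_irr e_conn e_col c_eq b_eq s_aut d4 xh xM conn_r;
  by apply: leq_trans h _; rewrite leq_mul2r ?k1 ?k2 orbT.
Qed.
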